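(* Let $G$ be a finite solvable group. If there exists a positive integer $\gamma$ such that every complemented chief factor of $G$ is a $\gamma$-module, then $G$ has the $(\gamma+1)$-intersection property.
   Context: A maximal intersection in a finite group $G$ is a subgroup of $G$ that is an intersection of maximal subgroups of $G$. For a positive real number $\eta$, $G$ has the $\eta$-intersection property if for every maximal intersection $H$ in $G$ there exists a family of maximal subgroups $M_1,\dots,M_t$ of $G$ such that $H=M_1\cap\dots\cap M_t$ and $|G:M_1|\cdots|G:M_t|\le|G:H|^\eta$. A chief factor $X/Y$ of $G$ is complemented if $X/Y$ has a complement in $G/Y$; it is regarded as an irreducible $G$-module by conjugation. Let $V$ be an irreducible $G$-module and $F=\operatorname{End}_G(V)$. $V$ is called a $\gamma$-module if for every $F$-subspace $W$ of $V$ there exists an $F$-subspace $W^*$ of $V$ such that (1) $\dim_F(W^* )\le\gamma$, and (2) $C_G(W)=C_G(W^* )\cap\bigl(\bigcap_{M\in\mathcal M_W}M\bigr)$, where $\mathcal M_W$ is the set of maximal subgroups of $G$ containing $C_G(W)$ (an empty intersection being $G$). *)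

(* Defs.v *)
From mathcomp Require Export all_boot all_order all_algebra.
From mathcomp Require Export reals exp.
From mathcomp Require Export all_fingroup all_solvable.

Set Implicit Arguments.
Unset Strict Implicit.
Unset Printing Implicit Defensive.

Import GroupScope.

Section IntersectionProperty.

Variable gT : finGroupType.
Implicit Types G H M : {group gT}.

(* The leading G :&: makes the intersection of the empty family G itself. *)
Definition maximal_intersection G H : Prop :=
  exists2 S : {set {group gT}},
    (forall M, M \in S -> maximal M G)
    & H = G :&: \bigcap_(M in S) M :> {set gT}.

Definition intersection_property (R : realType) (eta : R) G : Prop :=
  forall H, maximal_intersection G H ->
  exists (t : nat) (M : 'I_t -> {group gT}),
    [/\ forall i, maximal (M i) G,
        H = G :&: \bigcap_(i < t) M i :> {set gT}
      & (((\prod_(i < t) #|G : M i|)%N)%:R <= #|G : H|%:R `^ eta)%R].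

End IntersectionProperty.

(* A G-module is a finite abelian group V, written multiplicatively, on which
   G acts by automorphisms through the group action to. *)
Section GammaModule.

Variables (gT rT : finGroupType) (D : {group gT}) (A : {set rT}).
Variable to : groupAction D A.
Implicit Types (G M : {group gT}) (V W : {group rT}).

(* The G-endomorphisms of V, each extended by 1 outside V so that equality in
   module_end is equality of maps on V. As a field, module_end has pointwise
   product for addition, composition for multiplication and [ffun=> 1] for
   zero. *)
Definition module_end G V : {set {ffun rT -> rT}} :=
  [set f : {ffun rT -> rT} |
    [&& f \in pffun_on 1 V V, morphic V f
      & [forall g in G, forall v in V, f (to v g) == to (f v) g]]].

Definition end_subspace G V W : Prop :=
  W \subset V /\ (forall f w, f \in module_end G V -> w \in W -> f w \in W).

Definition end_basis G V W (n : nat) (b : 'I_n -> rT) : Prop :=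
  [/\ forall i, b i \in W,
      forall w, w \in W ->
        exists2 c : 'I_n -> {ffun rT -> rT},
          (forall i, c i \in module_end G V) & w = \prod_(i < n) c i (b i)
    & forall c : 'I_n -> {ffun rT -> rT},
        (forall i, c i \in module_end G V) ->
        \prod_(i < n) c i (b i) = 1 -> forall i, c i = [ffun=> 1]].

Definition end_dim G V W (n : nat) : Prop :=
  exists b : 'I_n -> rT, end_basis G V W b.

(* Meaningful when V is an irreducible G-module, so that module_end G V is a
   field. *)
Definition gamma_module (gamma : nat) G V : Prop :=
  forall W, end_subspace G V W ->
  exists Ws : {group rT},
    [/\ end_subspace G V Ws,
        exists2 n, end_dim G V Ws n & (n <= gamma)%N
      & 'C_G(W | to) =
        'C_G(Ws | to) :&:
          (G :&: \bigcap_(M : {group gT} |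
                          maximal M G && ('C_G(W | to) \subset M)) M)].

End GammaModule.

(* The factor is X / Y; as in chief_factor, the bottom Y comes first. *)
Definition complemented_chief_factor (gT : finGroupType) (G Y X : {group gT}) :=
  chief_factor G Y X && [splits G / Y, over X / Y].

(* Main.v *)
Require Import Defs.

(* Descend along a chief series of G.  For X normal in G let E_X be the
   intersection of the maximal subgroups containing H X; then E_G = G and
   E_1 = H, and it is enough to see that passing from X to Y, for a chief
   factor V = X / Y, costs at most gamma + 1 new maximal subgroups of index |V|,
   and only when some maximal M0 over H Y fails to contain X (then |G : H Y|
   gains a factor |V|).
     Any maximal M over H Y not containing X is, modulo Y, a complement of V,
   that is, the kernel of a derivation from G to V; compare it with that of M0.
   Either the difference of the two derivations is nonzero on C_G(V), and its
   kernel is a maximal M' over H X with M0 :&: M' = M0 :&: M; or it is zero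
   there, hence inner (H^1(G / C_G(V), V) = 0), and M = M0 ^ x with x in X.
   Therefore E_Y = E_X :&: M0 :&: C_G(W) with W = C_V(E_Y).  Since V is a
   gamma-module, W may be replaced by some W' spanned by b_1, ..., b_n with
   n <= gamma, the discarded maximal subgroups being already over E_X; and
   M0 :&: C_G(x Y) = M0 :&: M0 ^ x turns C_G(W') into n conjugates of M0. *)

Import GroupScope.

Set Implicit Arguments.
Unset Strict Implicit.
Unset Printing Implicit Defensive.

(** * Maximal subgroups complementing a minimal normal subgroup *)

Section Complements.

Variable gT : finGroupType.
Implicit Types G H K L M N T V X Y : {group gT}.

Lemma maximal_proper G M : maximal M G -> M \proper G.
Proof. by case/maxgroupP. Qed.

Lemma maximal_mul_normal G M N :
  maximal M G -> N <| G -> ~~ (N \subset M) -> N * M = G.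
Proof.
case/maxgroupP=> /andP[sMG _] maxM /andP[sNG nNG] not_sNM.
have nNM := subset_trans sMG nNG; rewrite -norm_joinEr //; apply/eqP.
have := maxM (N <*> M)%G; rewrite properEneq join_subG sNG sMG andbT joing_subr.
by case: eqP => // _ /(_ isT isT) defM; rewrite -defM joing_subl in not_sNM.
Qed.

Lemma minnormal_normal_sub G V L :
  minnormal V G -> G \subset 'N(L) -> L \subset V -> L :=: 1 \/ L :=: V.
Proof.
case/mingroupP=> _ minV nLG sLV; have [->|ntL] := eqVneq (L : {set gT}) 1.
  by left.
by right; apply: minV; rewrite ?ntL.
Qed.

(** [V :&: M] is normalised by [V], which is abelian, and by [M], hence by [V * M = G]; minimality
    of [V] leaves only 1 and [V]. *)
Lemma maximal_minnormal_TI G M V :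
  minnormal V G -> V <| G -> abelian V -> maximal M G -> ~~ (V \subset M) ->
  V :&: M = 1.
Proof.
move=> minV nsVG abV maxM not_sVM.
have defG := maximal_mul_normal maxM nsVG not_sVM.
have nVMG : G \subset 'N(V :&: M).
  rewrite -defG mul_subG //.
    by apply: sub_abelian_norm; rewrite ?subsetIl.
  apply: normsI (normG M); apply: subset_trans (normal_norm nsVG).
  exact/proper_sub/maximal_proper.
by case: (minnormal_normal_sub minV nVMG (subsetIl _ _)) => //= /setIidPl sVM;
   rewrite sVM in not_sVM.
Qed.

(* A minimal normal subgroup N / V of G / V has order prime to V, so the
   complements N :&: M and N :&: M0 of V in N are conjugate, and M, M0 are
   their normalizers. *)
Lemma self_centralizing_maximal_conj G V M M0 :
  solvable G -> minnormal V G -> V <| G -> 'C_G(V) = V ->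
  maximal M G -> maximal M0 G -> ~~ (V \subset M) -> ~~ (V \subset M0) ->
  exists2 x, x \in V & M :=: M0 :^ x.
Proof.
move=> solG minV nsVG cVG maxM maxM0 nVM nVM0.
have [[sVG nVG] [/proper_sub sMG /proper_sub sM0G]] :=
  (andP nsVG, (maximal_proper maxM, maximal_proper maxM0)).
have [_ ntV /is_abelemP[p p_pr abelV]] := minnormal_solvable minV sVG solG.
have [pV abV _] := and3P abelV.
have [tiM tiM0] : V :&: M = 1 /\ V :&: M0 = 1.
  by split; apply: (maximal_minnormal_TI minV).
have [defG defG0] : V * M = G /\ V * M0 = G.
  by split; apply: maximal_mul_normal.
(* If [V = G], both complements are trivial, and there is no minimal normal subgroup of [G / V] to
   work with. *)
have [sGV | not_sGV] := boolP (G \subset V).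
  have eqVG : V :=: G by apply/eqP; rewrite eqEsubset sVG.
  exists 1; first exact: group1.
  rewrite conjsg1; move: tiM tiM0; rewrite eqVG (setIidPr sMG) (setIidPr sM0G).
  by move=> -> ->.
have ntGV : G / V != 1 by rewrite -subG1 quotient_sub1.
have [Nb minNb sNbG] := minnormal_exists ntGV (normG _).
have [_ ntNb /is_abelemP[q q_pr abelN]] :=
  minnormal_solvable minNb sNbG (quotient_sol _ solG).
have nsNbG : Nb <| G / V by rewrite /normal sNbG; case/andP: (mingroupp minNb).
have [N defNb sVN nsNG] := inv_quotientN nsVG nsNbG.
have [sNG nNG] := andP nsNG; have nVN := subset_trans sNG nVG.
have not_sNV : ~~ (N \subset V) by rewrite -quotient_sub1 // -defNb subG1.
(* If [N] were a [p]-group, ['C_V(N)] would be nontrivial and normalised by [G], hence equal to [V];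
   then [N] would lie in ['C_G(V) = V]. *)
have not_pN : ~~ p.-group N.
  apply: contra not_sNV => pN; rewrite -{1}cVG subsetI sNG centsC.
  have nsVN : V <| N by apply: normalS nsVG.
  have := meet_center_nil (pgroup_nil pN) nsVN ntV.
  rewrite setIA (setIidPl sVN) => ntC.
  have nCG : G \subset 'N('C_V(N)) by rewrite normsI // norms_cent.
  have [/= eqC1 | /= <-] := minnormal_normal_sub minV nCG (subsetIl _ _).
    by rewrite eqC1 eqxx in ntC.
  exact: subsetIr.
have qNV : q.-group (N / V) by rewrite -defNb; case/and3P: abelN.
have neq_qp : q != p.
  apply: contra not_pN => /eqP eq_qp; rewrite eq_qp in qNV.
  by rewrite -(pquotient_pgroup pV nVN).
have modN L : V * L = G -> V * (N :&: L) = N.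
  by move=> defVL; rewrite setIC group_modl // defVL; apply/setIidPr.
have cardN L : V :&: L = 1 -> V * L = G -> #|N :&: L| = #|N / V|.
  move=> tiL /modN defN; rewrite card_quotient // -divgS // -{2}defN.
  by rewrite TI_cardMg ?mulKn ?cardG_gt0 // setICA tiL (setIidPr (sub1G _)).
have coVN : coprime #|V| #|N :&: M0|.
  rewrite cardN //; apply: (@pnat_coprime p) => //.
  by apply: pi_pnat qNV _; rewrite !inE.
have nVNM0 : N :&: M0 \subset 'N(V).
  by apply: subset_trans nVG; rewrite subIset ?sNG.
have sNMV : N :&: M \subset V * (N :&: M0) by rewrite modN ?subsetIl.
have eq_card : #|N :&: M| = #|N :&: M0| by rewrite !cardN.
have [x Vx defNM] :=
  SchurZassenhaus_trans_sol (abelian_sol abV) nVNM0 sNMV coVN eq_card.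
exists x => //.
(* By maximality the normaliser is [L] or [G]. If [G], then [[~: V, N :&: L]] lies in [V :&: L = 1],
   so [N :&: L] lies in ['C_G(V) = V], and so does [N = V * (N :&: L)]. *)
have defM L : maximal L G -> V :&: L = 1 -> V * L = G -> 'N_G(N :&: L) = L.
  move=> maxL tiL defVL; case/maxgroupP: maxL => /andP[sLG not_sGL] maxL.
  apply: maxL; last by rewrite subsetI sLG normsI ?normG // (subset_trans sLG).
  rewrite properEneq subsetIl andbT.
  apply: contra not_sNV => /eqP/setIidPl nNLG.
  have nVNL : N :&: L \subset 'N(V) by rewrite subIset ?nVN.
  have cNLV : N :&: L \subset V.
    rewrite -{1}cVG subsetI subIset ?sNG //=; apply/commG1P/trivgP.
    rewrite -tiL subsetI commg_subr nVNL.
    apply: subset_trans (subsetIr N L).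
    by rewrite commg_subl (subset_trans sVG).
  by rewrite -(modN L) // mul_subG.
by rewrite -(defM M) // -(defM M0) // defNM normJ conjIg conjGid ?(subsetP sVG).
Qed.

End Complements.

(** * Comparing two complements through their traces on the centraliser of [V] *)

Section MinimalNormal.

Variables (gT : finGroupType) (G V : {group gT}).
Implicit Types L M T : {group gT}.

Hypotheses (minV : minnormal V G) (nsVG : V <| G) (abV : abelian V).

Let nsCG : 'C_G(V) <| G.
Proof. by rewrite /normal subsetIl normsI ?normG ?norms_cent ?normal_norm. Qed.

Lemma centraliser_complement M :
  maximal M G -> ~~ (V \subset M) -> V * (M :&: 'C_G(V)) = 'C_G(V).
Proof.
move=> maxM nVM; have defG := maximal_mul_normal maxM nsVG nVM.
rewrite group_modl ?defG; first exact/setIidPr/normal_sub.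
by rewrite subsetI (normal_sub nsVG).
Qed.

(** [M] normalises the intersection, [V] centralises it, and [V * M = G]. *)
Lemma centraliser_complement_normal M :
  maximal M G -> ~~ (V \subset M) -> M :&: 'C_G(V) <| G.
Proof.
move=> maxM nVM; have defG := maximal_mul_normal maxM nsVG nVM.
have sMG := proper_sub (maximal_proper maxM).
apply/andP; split; first by rewrite subIset ?sMG.
rewrite -{1}defG mul_subG //; last first.
  by rewrite normsI ?normG // (subset_trans sMG) ?normal_norm.
by apply: cents_norm; rewrite centsC setIA subsetIr.
Qed.

(** By Dedekind's law, a subgroup [L] between [M :&: 'C_G(V)] and ['C_G(V)] is
    [(V :&: L) * (M :&: 'C_G(V))]. If [G] normalises [L], then [V :&: L] is 1 or [V]. *)
Lemma centraliser_complement_maxnormal M :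
  maximal M G -> ~~ (V \subset M) -> maxnormal (M :&: 'C_G(V)) 'C_G(V) G.
Proof.
move=> maxM nVM; have tiM := maximal_minnormal_TI minV nsVG abV maxM nVM.
have defC := centraliser_complement maxM nVM.
have nsKG := centraliser_complement_normal maxM nVM.
have sVC : V \subset 'C_G(V) by rewrite subsetI (normal_sub nsVG).
apply/maxgroupP; split=> [|L /andP[/andP[sLC not_sCL] nLG] sKL].
  rewrite properEneq subsetIr normal_norm // !andbT.
  by apply: contra nVM => /eqP/setIidPr sCM; apply: subset_trans sCM.
have defL : L = (V :&: L) * (M :&: 'C_G(V)) :> {set gT}.
  by rewrite setIC group_modr // defC; apply/esym/setIidPl.
have nVLG : G \subset 'N(V :&: L) by rewrite normsI ?(normal_norm nsVG).
have [/= eqVL | /= eqVL] := minnormal_normal_sub minV nVLG (subsetIl _ _).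
  by rewrite defL eqVL mul1g.
by rewrite defL eqVL defC subxx in not_sCL.
Qed.

(** Modulo the common trace [K] on ['C_G(V)], the image of [V] is its own centraliser, so the
    self-centralising case applies in [G / K]. *)
Lemma maximal_conj M M0 :
  solvable G -> maximal M G -> maximal M0 G ->
  ~~ (V \subset M) -> ~~ (V \subset M0) ->
  M :&: 'C_G(V) = M0 :&: 'C_G(V) -> exists2 x, x \in V & M :=: M0 :^ x.
Proof.
move=> solG maxM maxM0 nVM nVM0 eqK.
have nsKG := centraliser_complement_normal maxM nVM.
have defC := centraliser_complement maxM nVM.
have mxnK := centraliser_complement_maxnormal maxM nVM.
have tiM := maximal_minnormal_TI minV nsVG abV maxM nVM.
set K := (M :&: 'C_G(V))%G in nsKG defC mxnK.
have [sVG nVG] := andP nsVG; have [sKG nKG] := andP nsKG.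
have nKV := subset_trans sVG nKG.
have [sKM sKM0] : K \subset M /\ K \subset M0.
  by rewrite subsetIl /= eqK subsetIl.
have nsKM := normalS sKM (proper_sub (maximal_proper maxM)) nsKG.
have nsKM0 := normalS sKM0 (proper_sub (maximal_proper maxM0)) nsKG.
have eqCV : 'C_G(V) / K = V / K.
  by rewrite -defC quotientMidr.
(* If [L / K] centralises [V / K], then [[~: L, V]] lies in both [K] and [V], hence in
   [V :&: M = 1]. *)
have cVK : 'C_(G / K)(V / K) = V / K.
  apply/eqP; rewrite eqEsubset andbC subsetI quotientS //.
  rewrite -[_ \subset 'C(_)]/(abelian _) quotient_abelian //=.
  have [L defL sKL sLG] := inv_quotientS nsKG (subsetIl (G / K) 'C(V / K)).
  rewrite defL -eqCV quotientS // subsetI sLG; apply/commG1P/trivgP.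
  have nKL := subset_trans sLG nKG.
  have : L / K \subset 'C(V / K) by rewrite -defL subsetIr.
  rewrite quotient_cents2 // => sLVK; rewrite -tiM subsetI commg_subr.
  by rewrite (subset_trans sLG) // (subset_trans sLVK).
have minVK : minnormal (V / K) (G / K).
  rewrite -eqCV; apply: maxnormal_minnormal => //.
    by rewrite (subset_trans _ nKG) ?subsetIl.
  exact: normal_norm.
have notV L : ~~ (V \subset L) -> K <| L -> ~~ (V / K \subset L / K).
  by move=> nVL nsKL; rewrite quotientSGK // normal_sub.
have maxQ L : maximal L G -> K <| L -> maximal (L / K) (G / K).
  by move=> maxL nsKL; rewrite quotient_maximal.
have [xb /morphimP[x nKx Vx ->] defM] :=
  self_centralizing_maximal_conj (quotient_sol K solG) minVK
   (quotient_normal K nsVG) cVK (maxQ _ maxM nsKM) (maxQ _ maxM0 nsKM0)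
   (notV _ nVM nsKM) (notV _ nVM0 nsKM0).
exists x => //; apply: (quotient_inj (H := K)) => //=.
  by rewrite /= -(normP nKx) normalJ.
by rewrite quotientJ.
Qed.

(* The derivations from G to V with kernels M and M0 differ by a derivation
   whose kernel is V * (M :&: M0). *)
Lemma maximal_mulI M M0 :
  maximal M G -> maximal M0 G -> ~~ (V \subset M) -> ~~ (V \subset M0) ->
  M :&: 'C_G(V) <> M0 :&: 'C_G(V) -> maximal (V <*> (M :&: M0)) G.
Proof.
move=> maxM maxM0 nVM nVM0 neqK.
have defG := maximal_mul_normal maxM0 nsVG nVM0.
have tiM0 := maximal_minnormal_TI minV nsVG abV maxM0 nVM0.
have [defC defC0] :=
  (centraliser_complement maxM nVM, centraliser_complement maxM0 nVM0).
have [nsKG nsK0G] := (centraliser_complement_normal maxM nVM,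
                      centraliser_complement_normal maxM0 nVM0).
have mxnK := centraliser_complement_maxnormal maxM nVM.
set C := 'C_G(V) in neqK defC defC0 nsKG nsK0G mxnK *.
set K := M :&: C in neqK defC nsKG mxnK.
set K0 := M0 :&: C in neqK defC0 nsK0G.
have [sVG nVG] := andP nsVG; have sVC : V \subset C by rewrite subsetI sVG.
have [sMG sM0G] :=
  (proper_sub (maximal_proper maxM), proper_sub (maximal_proper maxM0)).
have nMM0V : M :&: M0 \subset 'N(V).
  by rewrite (subset_trans _ nVG) // subIset ?sMG.
(* [K] and [K0] both complement [V] in [C], so they have the same order, and an inclusion would be
   an equality. *)
have not_sK0M : ~~ (K0 \subset M).
  apply/negP=> sK0M; apply: neqK; apply/eqP; rewrite eq_sym eqEcard.
  rewrite subsetI sK0M subsetIr /=.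
  have tiV L : V :&: L = 1 -> #|V * (L :&: C)| = (#|V| * #|L :&: C|)%N.
    by move=> tiL; rewrite TI_cardMg // setIA tiL (setIidPl (sub1G _)).
  rewrite -(leq_pmul2l (cardG_gt0 V)) -!tiV ?defC ?defC0 //.
  exact: maximal_minnormal_TI minV nsVG abV maxM nVM.
have defM0 : K0 * (M :&: M0) = M0.
  rewrite group_modl ?subsetIl // (maximal_mul_normal maxM nsK0G not_sK0M).
  exact/setIidPr.
have dergC L : maximal L G -> ~~ (V \subset L) -> [~: C, C] \subset L :&: C.
  move=> maxL nVL; apply: der1_min.
    apply: subset_trans (subsetIl G 'C(V)) (normal_norm _).
    exact: centraliser_complement_normal.
  have defCL := centraliser_complement maxL nVL; rewrite -/C in defCL.
  move: (quotientMidr (L :&: 'C_G(V))%G V); rewrite /= -/C defCL => ->.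
  by rewrite quotient_abelian.
apply/maxgroupP; split=> [|T /andP[sTG not_sGT]].
  rewrite properEneq join_subG sVG subIset ?sMG //= andbT.
  apply: contra not_sK0M => /eqP eqG; apply: subset_trans (subsetIl M0 C) _.
  have := group_modr V (subsetIr M M0).
  rewrite -(norm_joinEr nMM0V) eqG setIC tiM0 mul1g (setIidPl sM0G) => <-.
  exact: subsetIl.
rewrite join_subG => /andP[sVT sMMT].
have sK0C : K0 \subset C by apply: subsetIr.
have sKK0T : K :&: K0 \subset T :&: K0.
  by rewrite subsetI subsetIr (subset_trans _ sMMT) // setISS ?subsetIl.
(* [G] is the product of [V], [K0] and [M :&: M0]. The first two lie in [C], which normalises
   [T :&: K0] because [[~: C, C]] lies in [K :&: K0]; the third lies in [T]. *)
have nTK0G : G \subset 'N(T :&: K0).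
  have nTK0C : C \subset 'N(T :&: K0).
    rewrite -commg_subl; apply: subset_trans sKK0T.
    apply: subset_trans (_ : [~: C, C] \subset _).
      by rewrite commSg // subIset ?sK0C ?orbT.
    by rewrite subsetI !dergC.
  have nTK0T : T \subset 'N(T :&: K0).
    by rewrite normsI ?normG // (subset_trans sTG) ?(normal_norm nsK0G).
  rewrite -defG -defM0 !mul_subG //; first exact: subset_trans nTK0C.
    exact: subset_trans nTK0C.
  exact: subset_trans nTK0T.
have sKC : K \subset C by apply: subsetIr.
have sLC : K <*> (T :&: K0) \subset C.
  by rewrite join_subG sKC subIset ?sK0C ?orbT.
have nLG : G \subset 'N(K <*> (T :&: K0)).
  by rewrite normsY ?(normal_norm nsKG).
(* [K <*> (T :&: K0)] is [C] or [K]. The first forces [K0] into [T], hence [T = G]. The second puts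
   [T :&: K0] in [M], so that [T :&: M0 = M :&: M0] and [T = V * (M :&: M0)]. *)
case/maxgroupP: mxnK => _ /(_ (K <*> (T :&: K0))%G).
rewrite properEneq sLC nLG joing_subl.
have [eqLC _|_ /(_ isT isT) defK] := eqVneq.
  case/negP: not_sGT; rewrite -defG -defM0 !mul_subG //.
  have : K0 \subset (K0 :&: K) * (T :&: K0).
    rewrite group_modr ?subsetIr // subsetI subxx.
    rewrite -norm_joinEr ?eqLC // subIset //.
    by rewrite (subset_trans sTG) ?(normal_norm nsKG).
  rewrite setIC => /subset_trans-> //.
  by rewrite mul_subG ?subsetIl // (subset_trans sKK0T) ?subsetIl.
have sTK0M : T :&: K0 \subset M.
  apply: subset_trans (subsetIl M C); move: defK; rewrite /= -/C -/K => <-.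
  exact: joing_subr.
have defT : V * (M0 :&: T) = T.
  by rewrite group_modl // defG; apply/setIidPr.
have defM0T : (T :&: K0) * (M :&: M0) = T :&: M0.
  by rewrite group_modr ?defM0.
apply/eqP; rewrite eqEsubset /= join_subG sVT sMMT andbT -defT norm_joinEr //.
by rewrite mulgS // subsetI subsetIl andbT setIC -defM0T mul_subG ?subsetIl.
Qed.

End MinimalNormal.

(** * Passing through one chief factor *)

Section ChiefStep.

Variables (gT : finGroupType) (G H : {group gT}).
Implicit Types L M T X Y : {group gT}.

(** Membership of [g] in [M :^ x] means that [[~ g, x^-1]] is in [M]; this commutator lies in [X],
    and [X :&: M = Y]. *)
Lemma mem_conj_complement X Y M x g :
  X \subset 'N(Y) -> M \subset 'N(Y) -> M \subset 'N(X) -> X :&: M = Y ->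
  x \in X -> g \in M -> (g \in M :^ x) = (coset Y g \in 'C[coset Y x]).
Proof.
move=> nYX nYM nXM tiM Xx Mg.
have [nYx nYg] := (subsetP nYX x Xx, subsetP nYM g Mg).
have nYc : [~ g, x^-1] \in 'N(Y) by rewrite groupR ?groupV.
have Xc : [~ g, x^-1] \in X.
  by rewrite commgEr groupM ?memJ_norm ?groupV ?(subsetP nXM).
have memMY : ([~ g, x^-1] \in M) = ([~ g, x^-1] \in Y) by rewrite -tiM inE Xc.
have cV : (coset Y g \in 'C[coset Y x]) = (coset Y g \in 'C[coset Y x^-1]).
  by rewrite morphV // cent1C [RHS]cent1C groupV.
rewrite mem_conjg conjg_mulR groupMl // memMY cV.
apply/idP/cent1P=> [Yc | /commgP/eqP cgx].
  by apply/commgP; rewrite -morphR ?groupV //=; apply/eqP/coset_id.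
by apply: coset_idr; rewrite // morphR ?groupV.
Qed.

(** The group E_X of the overview. *)
Definition maximal_meet X : {group gT} :=
  [group of G :&:
    \bigcap_(M : {group gT} | maximal M G && (H <*> X \subset M)) M].

Lemma maximal_meetP X g :
  reflect (g \in G /\ forall M, maximal M G -> H <*> X \subset M -> g \in M)
          (g \in maximal_meet X).
Proof.
rewrite inE; apply: (iffP andP) => [] [Gg maxg]; split=> //.
  by move=> M maxM sHXM; apply: (bigcapP maxg); rewrite maxM.
by apply/bigcapP=> M /andP[maxM sHXM]; apply: maxg.
Qed.

Lemma maximal_meet_sub X M :
  maximal M G -> H <*> X \subset M -> maximal_meet X \subset M.
Proof. by move=> maxM sHXM; apply/subsetP=> g /maximal_meetP[_]; apply. Qed.

Lemma sub_maximal_meet X T :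
  T \subset G -> (forall M, maximal M G -> H <*> X \subset M -> T \subset M) ->
  T \subset maximal_meet X.
Proof.
move=> sTG sTM; apply/subsetP=> g Tg; apply/maximal_meetP.
split=> [|M maxM sHXM]; first exact: (subsetP sTG).
exact: (subsetP (sTM M _ _)).
Qed.

Section Step.

Variables (X Y : {group gT}).
Hypotheses (solG : solvable G) (sHG : H \subset G).
Hypothesis chiefXY : chief_factor G Y X.

Let nsXG : X <| G. Proof. by case/andP: chiefXY. Qed.
Let ltYX : Y \proper X.
Proof. by case/andP: chiefXY => /maxgroupP[/andP[]]. Qed.
Let nsYG : Y <| G.
Proof.
case/andP: chiefXY => /maxgroupP[/andP[/proper_sub sYX nYG] _] /normal_sub sXG.
by rewrite /normal (subset_trans sYX).
Qed.
Let nYX : X \subset 'N(Y).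
Proof. exact: subset_trans (normal_sub nsXG) (normal_norm nsYG). Qed.
Let minV : minnormal (X / Y) (G / Y).
Proof. exact: chief_factor_minnormal. Qed.
Let nsVG : X / Y <| G / Y. Proof. exact: quotient_normal. Qed.
Let abV : abelian (X / Y).
Proof.
have solGY := quotient_sol Y solG.
have [_ _] := minnormal_solvable minV (normal_sub nsVG) solGY.
by case/is_abelemP=> p _ /and3P[].
Qed.

Let maxQ M : maximal M G -> Y \subset M -> maximal (M / Y) (G / Y).
Proof.
move=> maxM sYM; have sMG := proper_sub (maximal_proper maxM).
by rewrite quotient_maximal ?(normalS sYM sMG nsYG).
Qed.

Let notV M : Y \subset M -> ~~ (X \subset M) -> ~~ (X / Y \subset M / Y).
Proof.
by move=> sYM nXM; rewrite quotientSGK.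
Qed.

Lemma chief_factor_maximal_TI M :
  maximal M G -> Y \subset M -> ~~ (X \subset M) -> X :&: M = Y.
Proof.
move=> maxM sYM nXM; apply/eqP.
rewrite eqEsubset subsetI sYM (proper_sub ltYX) !andbT.
rewrite -quotient_sub1; last first.
  exact: subset_trans (subsetIl X M) nYX.
rewrite quotientIG //.
by rewrite (maximal_minnormal_TI minV nsVG abV (maxQ maxM sYM) (notV sYM nXM)).
Qed.

Lemma chief_factor_complemented M :
  maximal M G -> Y \subset M -> ~~ (X \subset M) ->
  complemented_chief_factor G Y X.
Proof.
move=> maxM sYM nXM; rewrite /complemented_chief_factor chiefXY; apply/splitsP.
exists (M / Y)%G; apply/complP; split.
  exact: maximal_minnormal_TI minV nsVG abV (maxQ maxM sYM) (notV sYM nXM).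
exact: maximal_mul_normal (maxQ maxM sYM) nsVG (notV sYM nXM).
Qed.

Lemma maximal_meet_chief gamma M0 :
  gamma_module ('J / Y)%gact gamma G (X / Y)%G ->
  maximal M0 G -> H <*> Y \subset M0 -> ~~ (X \subset M0) ->
  exists n (x : 'I_n -> gT), [/\ n <= gamma, forall i, x i \in X &
    maximal_meet Y =
      maximal_meet X :&: M0 :&: \bigcap_(i < n) M0 :^ x i :> {set gT}].
Proof.
move=> gammaV maxM0 sHYM0 nXM0.
have [sHM0 sYM0] : H \subset M0 /\ Y \subset M0.
  by move: sHYM0; rewrite join_subG => /andP[].
have [sXG nXG] := andP nsXG; have [sYG nYG] := andP nsYG.
have sM0G := proper_sub (maximal_proper maxM0).
have tiM0 := chief_factor_maximal_TI maxM0 sYM0 nXM0.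
have nXM0' := subset_trans sM0G nXG; have nYM0 := subset_trans sM0G nYG.
have memJ x g : x \in X -> g \in M0 ->
    (g \in M0 :^ x) = (coset Y g \in 'C[coset Y x]).
  exact: mem_conj_complement.
set EX := maximal_meet X; set EY := maximal_meet Y.
have sEG : EY \subset G by apply: subsetIl.
have sEXY : EY \subset EX.
  apply: sub_maximal_meet => // M maxM sHXM; apply: maximal_meet_sub => //.
  by apply: subset_trans sHXM; rewrite genS // setUS // proper_sub.
have sEM0 : EY \subset M0 by apply: maximal_meet_sub.
pose W := 'C_(X / Y)(EY / Y)%G.
have nYE := subset_trans sEG nYG.
(* Module endomorphisms preserve the fixed points of [g]. This makes [W] a subspace, and lets
   centralising [Ws] be tested on a basis. *)
have fixE f v g : f \in module_end ('J / Y)%gact G (X / Y)%G -> v \in X / Y ->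
    g \in G -> commute v (coset Y g) ->
    f v \in X / Y /\ commute (f v) (coset Y g).
  rewrite inE => /and3P[/pffun_onP[_ Vf] _ /forall_inP Gf] Vv Gg cvg.
  split; first exact: Vf (image_f f Vv).
  have /forall_inP/(_ v Vv)/eqP := Gf g Gg.
  rewrite !qactJ (subsetP nYG) //; move/commgP/conjg_fixP: cvg => -> eqf.
  exact/commgP/conjg_fixP/esym.
have sHYE : H <*> Y \subset EY.
  by apply: sub_maximal_meet => //; rewrite join_subG sHG.
have endW : end_subspace ('J / Y)%gact G (X / Y)%G W.
  split=> [|f w]; first exact: subsetIl.
  move=> endf /setIP[Vw cEw].
  rewrite inE; apply/andP; split.
    by case: (fixE f w 1 endf Vw) => //; rewrite morph1; apply: commute1.
  apply/centP=> _ /morphimP[e nYe Ee ->].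
  case: (fixE f w e endf Vw (subsetP sEG e Ee)) => //.
  by apply: (centP cEw); apply: mem_quotient.
have [Ws [[sWsV endWs] [n [b [Wsb genb _]] le_n_gamma] defCW]] := gammaV W endW.
have cW : EY \subset 'C_G(W | ('J / Y)%gact).
  by rewrite subsetI sEG astabQ -sub_quotient_pre // centsC subsetIr.
have cVW : X \subset 'C_G(W | ('J / Y)%gact).
  rewrite subsetI sXG astabQ -sub_quotient_pre //.
  exact: subset_trans abV (centS (subsetIl _ _)).
(* The conjugating elements are representatives in [X] of the basis vectors of [Ws]. *)
have /fin_all_exists2[x Xx defb] i : exists2 x, x \in X & b i = coset Y x.
  have /(subsetP sWsV)/morphimP[x _ Xx ->] := Wsb i.
  by exists x.
exists n, x; split=> //.
have subM0J i g : g \in 'C_G(Ws | ('J / Y)%gact) -> g \in M0 -> g \in M0 :^ x i.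
  rewrite astabQ => /setIP[_ /morphpreP[_ cWsg]] M0g.
  by rewrite memJ // -defb; apply/cent1P; apply: (centP cWsg).
apply/eqP; rewrite eqEsubset; apply/andP; split.
  rewrite 2!subsetI sEXY sEM0; apply/bigcapsP=> i _; apply/subsetP=> e Ee.
  apply: subM0J; last exact: (subsetP sEM0).
  by have /(subsetP cW) := Ee; rewrite defCW => /setIP[].
apply/subsetP=> g /setIP[/setIP[EXg M0g] /bigcapP M0xg].
have Gg : g \in G by apply: (subsetP sM0G).
(* The conjugates of [M0] give that [g] centralises [Ws]; the other maximal subgroups in the
   condition contain ['C_G(W)], hence [H] and [X], so they contain [EX]. *)
have CWg : g \in 'C_G(W | ('J / Y)%gact).
  rewrite defCW inE; apply/andP; split.
    rewrite inE Gg astabQ; apply/morphpreP; split; first exact: (subsetP nYM0).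
    apply/centP=> w Wsw; have [c endc ->] := genb w Wsw.
    apply/cent1P; rewrite cent1C; apply: group_prod => i _; apply/cent1P.
    case: (fixE (c i) (b i) g) => //; first exact: (subsetP sWsV).
    apply/esym; rewrite defb; apply/cent1P; rewrite -memJ //.
    exact: M0xg.
  rewrite inE Gg; apply/bigcapP=> M /andP[maxM sCM].
  case/maximal_meetP: EXg => _; apply=> //.
  rewrite join_subG !(subset_trans _ sCM) //.
  by apply: subset_trans cW; apply: subset_trans sHYE; apply: joing_subl.
apply/maximal_meetP; split=> // M maxM; rewrite join_subG => /andP[sHM sYM].
have [sXM | nXM] := boolP (X \subset M).
  by case/maximal_meetP: EXg => _; apply; rewrite // join_subG sHM.
have [eqK | neqK] := eqVneq (M / Y :&: 'C_(G / Y)(X / Y))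
                            (M0 / Y :&: 'C_(G / Y)(X / Y)).
  have [xb /morphimP[y nYy Xy ->] defM] :=
    maximal_conj minV nsVG abV (quotient_sol Y solG) (maxQ maxM sYM)
     (maxQ maxM0 sYM0) (notV sYM nXM) (notV sYM0 nXM0) eqK.
  have sMG := proper_sub (maximal_proper maxM).
  have eqM : M :=: M0 :^ y.
    apply: (quotient_inj (H := Y)); last by rewrite /= quotientJ.
      exact: normalS sYM sMG nsYG.
    by rewrite /= -(normP nYy) normalJ (normalS sYM0 sM0G nsYG).
  (* [EY] lies in both [M0] and [M = M0 :^ y], so it fixes the coset of [y]; as [g] centralises [W],
     it then lies in [M0 :^ y]. *)
  have Wy : coset Y y \in W.
    rewrite inE mem_quotient //; apply/centP=> _ /morphimP[e _ Ee ->].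
    apply/esym/cent1P; rewrite -memJ ?(subsetP sEM0) // -eqM.
    by apply: (subsetP (maximal_meet_sub maxM _) e Ee); rewrite join_subG sHM.
  rewrite eqM memJ //; apply/cent1P.
  by move: CWg; rewrite astabQ => /setIP[_ /morphpreP[_ /centP]]; apply.
have maxMM0 := maximal_mulI minV nsVG abV (maxQ maxM sYM) (maxQ maxM0 sYM0)
  (notV sYM nXM) (notV sYM0 nXM0) (elimN eqP neqK).
have nMM0X : M :&: M0 \subset 'N(X) by rewrite subIset ?nXM0' ?orbT.
have sMM0X : X <*> (M :&: M0) \subset G.
  by rewrite join_subG sXG subIset ?sM0G ?orbT.
have sYX := proper_sub ltYX.
have {}maxMM0 : maximal (X <*> (M :&: M0)) G.
  rewrite -(quotient_maximal (K := Y)) //; last first.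
    by apply: normalS sMM0X nsYG; rewrite (subset_trans sYX) ?joing_subl.
  by rewrite /= quotientY ?subIset ?nYM0 ?orbT // quotientGI.
(* [g] lies in [M0] and in the maximal subgroup [X <*> (M :&: M0)], which contains [H <*> X]. By
   Dedekind's law it lies in [Y * (M :&: M0)], hence in [M]. *)
have : g \in (X :&: M0) * (M :&: M0).
  rewrite (setIC X) group_modr ?subsetIr // -norm_joinEr // inE M0g.
  case/maximal_meetP: EXg => _; apply => //.
  rewrite join_subG joing_subl andbT (subset_trans _ (joing_subr _ _)) //.
  by rewrite subsetI sHM.
by rewrite tiM0; apply: subsetP; rewrite mul_subG ?subsetIl.
Qed.

(** As [M0 * (H <*> X) = G], the index of [M0] is that of [(H <*> X) :&: M0] in [H <*> X], and this
    intersection contains [H <*> Y]. *)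
Lemma index_chief_step M0 :
  maximal M0 G -> H <*> Y \subset M0 -> ~~ (X \subset M0) ->
  (#|G : H <*> X| * #|G : M0| <= #|G : H <*> Y|)%N.
Proof.
move=> maxM0 sHYM nXM.
have defG : M0 * (H <*> X) = G.
  apply/eqP; rewrite eqEsubset mul_subG ?join_subG ?sHG ?(normal_sub nsXG) //=.
    rewrite -{1}(maximal_mul_normal maxM0 nsXG nXM) -normC.
      by rewrite mulgS ?joing_subr.
    exact: subset_trans (proper_sub (maximal_proper maxM0)) (normal_norm nsXG).
  exact: proper_sub (maximal_proper maxM0).
have -> : #|G : M0| = #|H <*> X : (H <*> X) :&: M0|.
  by rewrite indexgI -[RHS]indexMg defG.
rewrite Lagrange_index ?subsetIl //; last first.
  by rewrite join_subG sHG normal_sub.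
rewrite dvdn_leq ?indexg_gt0 // indexgS // subsetI sHYM andbT.
rewrite join_subG joing_subl.
exact: subset_trans (proper_sub ltYX) (joing_subr H X).
Qed.

End Step.
End ChiefStep.

(** * Descent along a chief series and conclusion *)

Lemma maximal_meet_small_family (gT : finGroupType) (G H X : {group gT}) gamma :
  solvable G -> H \subset G ->
  (forall X Y : {group gT}, complemented_chief_factor G Y X ->
     gamma_module ('J / Y)%gact gamma G (X / Y)%G) ->
  X <| G ->
  exists s : seq {group gT},
    [/\ forall M, M \in s -> maximal M G,
        maximal_meet G H X
          =i [pred g in G | all (fun M : {group gT} => g \in M) s]
      & (\prod_(M <- s) #|G : M| <= #|G : H <*> X| ^ gamma.+1)%N].
Proof.
(* Induction on the index starts with the empty family at [G]; each step takes a chief factor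
   [X / Y] just above the current [Y]. *)
move=> solG sHG gammaP; have [k] := ubnP #|G : X|.
elim: k X => // k IHk Y; rewrite ltnS => leYk nsYG.
have [sGY | not_sGY] := boolP (G \subset Y).
  exists [::]; split=> // [g|].
    rewrite [RHS]inE andbT; apply/maximal_meetP/idP => [[] //|Gg].
    split=> // M maxM.
    rewrite join_subG => /andP[_ sYM]; apply: (subsetP sYM).
    exact: (subsetP sGY).
  by rewrite big_nil expn_gt0 indexg_gt0.
have ntGY : G / Y != 1 by rewrite -subG1 quotient_sub1 ?normal_norm.
have [Xb minXb sXbG] := minnormal_exists ntGY (normG _).
have nsXbG : Xb <| G / Y.
  by rewrite /normal sXbG; case/mingroupP: minXb => /andP[].
have [X defXb sYX nsXG] := inv_quotientN nsYG nsXbG.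
have chiefXY : chief_factor G Y X.
  rewrite /chief_factor nsXG andbT; apply: minnormal_maxnormal.
  - exact: normalS sYX (normal_sub nsXG) nsYG.
  - exact: normal_norm.
  by rewrite -defXb.
have ltYX : Y \proper X.
  by case/andP: chiefXY => /maxgroupP[/andP[]].
have ltXk : #|G : X| < k.
  apply: leq_trans leYk.
  rewrite -(Lagrange_index (normal_sub nsXG) sYX).
  by rewrite ltn_Pmulr ?indexg_gt1 ?proper_subn.
have [s [maxs memEX les]] := IHk X ltXk nsXG.
have sHYX : H <*> Y \subset H <*> X by rewrite genS // setUS.
have [M0 /and3P[maxM0 sHYM0 nXM0] | noM0] :=
  pickP [pred M : {group gT} |
           [&& maximal M G, H <*> Y \subset M & ~~ (X \subset M)]].
- have sYM0 := subset_trans (joing_subr H Y) sHYM0.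
  have cXY := chief_factor_complemented solG chiefXY maxM0 sYM0 nXM0.
  have [n [x [le_n Xx defE]]] :=
    maximal_meet_chief solG sHG chiefXY (gammaP X Y cXY) maxM0 sHYM0 nXM0.
  have Gx i : x i \in G by apply: (subsetP (normal_sub nsXG)).
  pose t := [seq (M0 :^ x i)%G | i <- enum 'I_n].
  exists (M0 :: t ++ s); split=> [M|g|].
  + rewrite inE mem_cat => /predU1P[-> // | /orP[/mapP[i _ ->]|]].
      by rewrite -(conjGid (Gx i)) maximalJ.
    exact: maxs.
  + rewrite defE 2!inE memEX !inE /= all_cat all_map.
    have -> : (g \in \bigcap_(i < n) M0 :^ x i) =
              all (fun i => g \in M0 :^ x i) (enum 'I_n).
      apply/bigcapP/allP => [gM i _|gM i _]; first exact: gM.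
      by apply: gM; rewrite mem_enum.
    by rewrite -!andbA; congr (_ && _); rewrite andbC -andbA.
  rewrite big_cons big_cat big_map /=.
  have -> : (\prod_(i <- enum 'I_n) #|G : M0 :^ x i| = #|G : M0| ^ n)%N.
    rewrite (eq_bigr (fun=> #|G : M0|)) => [|i _].
      by rewrite big_const_seq count_predT size_enum_ord iter_muln_1.
    by rewrite -{1}(conjGid (Gx i)) indexJg.
  (* [M0] and its [n] conjugates contribute [#|G : M0| ^ n.+1], with [n <= gamma]: this is where the
     exponent [gamma.+1] arises. *)
  rewrite mulnA -expnS mulnC.
  apply: leq_trans (leq_mul les (_ : _ <= #|G : M0| ^ gamma.+1)%N) _.
    by rewrite leq_pexp2l.
  by rewrite -expnMn leq_exp2r // index_chief_step.
(* Every maximal subgroup over [H <*> Y] now contains [X], so E_Y = E_X and the same family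
   serves. *)
exists s; split=> // [g|].
  rewrite -memEX.
  apply/maximal_meetP/maximal_meetP=> -[Gg maxg]; split=> // M maxM sHM.
    by apply: maxg => //; apply: subset_trans sHM.
  apply: maxg => //; have := noM0 M; rewrite /= maxM sHM /= => /negbFE sXM.
  by rewrite join_subG sXM (subset_trans (joing_subl H Y)).
by apply: leq_trans les _; rewrite leq_exp2r // dvdn_leq ?indexg_gt0 ?indexgS.
Qed.

Theorem corollary8 (R : realType) (gT : finGroupType) (G : {group gT})
    (gamma : nat) :
  solvable G ->
  (0 < gamma)%N ->
  (forall X Y : {group gT}, complemented_chief_factor G Y X ->
     gamma_module ('J / Y)%gact gamma G (X / Y)%G) ->
  intersection_property (gamma%:R + 1 : R)%R G.
Proof.
move=> solG _ gammaP H [S maxS defH].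
have sHG : H \subset G by rewrite defH subsetIl.
have [s [maxs memE les]] :=
  maximal_meet_small_family solG sHG gammaP (normal1 G).
exists (size s), (tnth (in_tuple s)); split=> [i||].
- by apply: maxs; apply: mem_tnth.
(* An intersection of maximal subgroups is the intersection of all the maximal subgroups containing
   it. *)
- have -> : H = maximal_meet G H 1 :> {set gT}.
    apply/eqP; rewrite eqEsubset sub_maximal_meet //=; last first.
      by move=> M _; rewrite joingG1.
    rewrite {2}defH subsetI subsetIl; apply/bigcapsP=> M SM.
    apply: maximal_meet_sub (maxS M SM) _; rewrite joingG1 defH subIset //.
    by rewrite bigcap_inf ?orbT.
  apply/setP=> g; rewrite memE !inE; congr (_ && _).
  apply/allP/bigcapP => [gs i _|gs M Ms].
    exact/gs/mem_tnth.
  by have /(tnthP (in_tuple s))[i ->] := Ms; apply: gs.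
rewrite joingG1 in les.
rewrite GRing.natr1 powR_mulrn ?Num.Theory.ler0n //.
rewrite -GRing.natrX Num.Theory.ler_nat.
by apply: leq_trans les; rewrite (big_tnth _ _ s).
Qed.
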